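(* Let $B(q) = \frac{2}{q\pi^{q+1}}$ and, for $q>0$ and $x \in (0,\pi/2)$, let $$\varphi_{B(q),q}(x) = \frac{\sin x}{x} - \frac{2}{\pi} - B(q)\left(\pi^q - (2x)^q\right).$$ Let $q_1 = \frac{\pi^2}{4}-1 = 1.46740\ldots$ and $q_2 = \frac{2}{\pi-2} = 1.75193\ldots$. Then: (i) If $q \in (0, q_1]$, then for all $x \in (0, \pi/2)$ $$\frac{\sin x}{x} < \frac{2}{\pi} + B(q_1)\left(\pi^{q_1} - (2x)^{q_1}\right) \leq \frac{2}{\pi} + B(q)\left(\pi^q - (2x)^q\right),$$ and the constant $q_1$ is the best possible. (ii) If $q \in (q_1, q_2)$, then the equation $\varphi_{B(q),q}(x) = 0$ has a unique solution $x_0^{(q)}$ in $(0,\pi/2)$, and $$x \in \left(0, x_0^{(q)}\right) \Longrightarrow \frac{\sin x}{x} < \frac{2}{\pi} + B(q)\left(\pi^q - (2x)^q\right),$$ $$x \in \left(x_0^{(q)}, \frac{\pi}{2}\right) \Longrightarrow \frac{\sin x}{x} > \frac{2}{\pi} + B(q)\left(\pi^q - (2x)^q\right).$$ (iii) If $q \in [q_2, +\infty)$, then for all $x \in (0,\pi/2)$ $$\frac{\sin x}{x} > \frac{2}{\pi} + B(q_2)\left(\pi^{q_2} - (2x)^{q_2}\right) \geq \frac{2}{\pi} + B(q)\left(\pi^q - (2x)^q\right),$$ and the constant $q_2$ is the best possible. (iv) For each $q \in (q_1, q_2]$, the function $\varphi_{B(q),q}$ has exactly one maximum on $(0,\pi/2)$,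 at a point $m^{(q)} \in (0,\pi/2)$. (v) The equation $$\left|\varphi_{B(q),q}(0+)\right| = \left|\varphi_{B(q),q}\left(m^{(q)}\right)\right|$$ has, for the parameter $q \in (q_1, q_2)$, the solution $q = q_0$, numerically determined as $q_0 = 1.72287\ldots$. For the value $$d_0 = \left|\varphi_{B(q_0),q_0}(0+)\right| = \left|\varphi_{B(q_0),q_0}\left(m^{(q_0)}\right)\right| = 0.0061296\ldots$$ it holds $$d_0 = \inf_{q \in (0,\infty)} \ \sup_{x \in (0,\pi/2)} \left|\varphi_{B(q),q}(x)\right|.$$ Hence the minimax approximant of the family $\varphi_{B(q),q}$ ($q>0$) is $\varphi_{B(q_0),q_0}(x) = \frac{\sin x}{x} - \frac{2}{\pi} - B(q_0)\left(\pi^{q_0} - (2x)^{q_0}\right)$, which determines the corresponding minimax approximation $\frac{\sin x}{x} \approx \frac{2}{\pi} + B(q_0)\left(\pi^{q_0} - (2x)^{q_0}\right)$, with $B(q_0) = 0.051415\ldots$.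
   Context: ''Maximum'' on the open interval $(0,\pi/2)$ in (iv) means local maximum at an interior point. The notation $f(0+)$ means $\lim_{x\to 0+} f(x)$. ''Best possible'' in (i) means that $q_1$ is the largest $q$ for which $\frac{\sin x}{x} < \frac{2}{\pi} + B(q)(\pi^q-(2x)^q)$ holds for all $x \in (0,\pi/2)$; in (iii) it means that $q_2$ is the smallest $q$ for which $\frac{\sin x}{x} > \frac{2}{\pi} + B(q)(\pi^q-(2x)^q)$ holds for all $x\in(0,\pi/2)$. Minimax approximant: for a family of functions $\varphi_q(x)$, $x \in (a,b)$, $q \in \mathbb{R}^+ = (0,\infty)$, if the infimum over $q$ of the error $d(q) = \sup_{x\in(a,b)}|\varphi_q(x)|$ is attained at $q = q_0 \in \mathbb{R}^+$, then $\varphi_{q_0}$ is called the minimax approximant of the family on $(a,b)$. A decimal followed by ''$\ldots$'' gives the leading digits of the decimal expansion. *)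

(* Defs.v *)
From Stdlib Require Import Reals.
From Coquelicot Require Import Coquelicot.

Local Open Scope R_scope.

Definition B (q : R) : R := 2 / (q * Rpower PI (q + 1)).

Definition approx (q x : R) : R :=
  2 / PI + B q * (Rpower PI q - Rpower (2 * x) q).

Definition phi (q x : R) : R :=
  sin x / x - 2 / PI - B q * (Rpower PI q - Rpower (2 * x) q).

Definition q1 : R := PI ^ 2 / 4 - 1.

Definition q2 : R := 2 / (PI - 2).

(* The decimal expansion of [x >= 0] starts with the [k]-decimal number [c]
   (truncation, not rounding). *)
Definition leading_digits (k : nat) (c x : R) : Prop :=
  c <= x < c + / 10 ^ k.

Definition local_max_on (f : R -> R) (a b m : R) : Prop :=
  a < m < b /\
  exists eps : R, 0 < eps /\
    forall x : R, a < x < b -> Rabs (x - m) < eps -> f x <= f m.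

Definition right_limit (f : R -> R) (a l : R) : Prop :=
  filterlim f (at_right a) (locally l).

Definition sup_error (f : R -> R -> R) (a b q : R) : Rbar :=
  Lub_Rbar (fun y => exists x : R, a < x < b /\ y = Rabs (f q x)).

(* Only the finite values of [sup_error] are collected: infinite ones do not
   change the infimum. *)
Definition min_error (f : R -> R -> R) (a b : R) : Rbar :=
  Glb_Rbar (fun d => exists q : R, 0 < q /\ sup_error f a b q = Finite d).

(* [f q0] is the minimax approximant of the family [f q], [q > 0], on (a, b). *)
Definition minimax_approximant (f : R -> R -> R) (a b q0 : R) : Prop :=
  0 < q0 /\ sup_error f a b q0 = min_error f a b.

(* Main.v *)
Require Import Defs.
From Stdlib Require Import Reals Lra Classical.
From Coquelicot Require Import Coquelicot.

Local Open Scope R_scope.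

(** With [u = 2 * x / PI] in (0, 1), the error function is
[phi q x = sin x / x - 2 / PI - 2 / PI * ((1 - u ^ q) / q)]. Two monotonicity facts
carry the proof.

In the exponent: [(1 - u ^ q) / q] strictly decreases in [q], so [phi] strictly
increases in [q] ([phi_increasing_q]). Hence the comparisons between different
exponents in (i) and (iii) are immediate, and only [q1] and [q2] themselves have to
be treated.

In [x]: the derivative of [phi q] is [(u ^ (q + 1) - w x) / x ^ 2] with
[w x = sin x - x * cos x], so its sign is that of
[log_ratio q x = (q + 1) * ln u - ln (w x)]. The derivative of the latter is
[(q + 1 - elasticity x) / x], where [elasticity x = x ^ 2 * sin x / w x] is the
derivative of [ln w] with respect to [ln x]. The elasticity strictly
decreases on (0, PI), and at [PI / 2] it equals [PI ^ 2 / 4 = q1 + 1]. Consequently: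
- for [q = q1] the derivative of [phi q] is positive on (0, PI/2), and since [phi q]
  vanishes at [PI / 2], it is negative on the interval;
- for [q1 < q <= q2] the function [phi q] increases up to a point [peak q] and
  decreases afterwards to 0 ([peak_spec]); the limit [phi0 q] at 0+ is negative for
  [q < q2] and zero for [q = q2], which gives one sign change or none.

For [q1 < q < q2] the two extreme values of [phi q] are therefore [phi0 q < 0] and
[phi q (peak q) > 0]. Their sum [balance q] strictly increases in [q] and is
continuous, because [phi q' x - phi q x <= phi0 q' - phi0 q] for [q < q']
([phi_gap_le]). Its zero [q0] equalizes the two extreme errors and is optimal: a larger
exponent increases [phi] at [peak q0], and a smaller one decreases the limit at 0+
([min_error_balanced]).

The decimals require [q0] to lie between [q_lo = 1.7228764] and [q_hi = 1.722876429].
The upper end is delicate: [d0] exceeds 0.0061296 by only 3.3e-10, so [q0] must be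
bounded above with an error of at most 1.5e-9. Fortunately, this side
([balance_hi]) only asks for a lower bound of [phi q_hi] at a single point. The lower
end ([balance_lo]) needs an upper bound of the maximum of [phi q_lo], obtained by
enclosing [peak q_lo] between two points and applying the mean value theorem. The
points are taken of the form [PI / 2 * exp (- r)] with [r] rational, so that all powers
of [u] are exponentials of rational numbers. *)

(** * Monotonicity and one-sided limits *)

(** The intermediate point is strictly inside the interval, so that strict sign
conditions are only needed there and may fail at the end points. *)
Lemma MVT_open (f f' : R -> R) (a b : R) :
  a < b -> (forall x, a <= x <= b -> is_derive f x (f' x)) ->
  exists c, a < c < b /\ f b - f a = f' c * (b - a).
Proof.
  intros ab Hf.
  destruct (MVT_cor2 f f' a b ab) as [c [E Hc]].
  - intros c Hc. apply is_derive_Reals, Hf, Hc.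
  - exists c; tauto.
Qed.

Lemma strict_increase (f f' : R -> R) (a b : R) :
  a < b -> (forall x, a <= x <= b -> is_derive f x (f' x)) ->
  (forall x, a < x < b -> 0 < f' x) -> f a < f b.
Proof.
  intros ab Hf Hp.
  destruct (MVT_open f f' a b ab Hf) as [c [Hc E]].
  specialize (Hp c Hc).
  assert (0 < f' c * (b - a)) by (apply Rmult_lt_0_compat; lra).
  lra.
Qed.

Lemma strict_decrease (f f' : R -> R) (a b : R) :
  a < b -> (forall x, a <= x <= b -> is_derive f x (f' x)) ->
  (forall x, a < x < b -> f' x < 0) -> f b < f a.
Proof.
  intros ab Hf Hn.
  enough (- f a < - f b) by lra.
  apply (strict_increase (fun x => - f x) (fun x => - f' x)); trivial.
  - intros x Hx. apply (is_derive_opp f), Hf, Hx.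
  - intros x Hx. specialize (Hn x Hx). lra.
Qed.

Lemma at_right_interval (a b : R) : a < b -> at_right a (fun x => a < x < b).
Proof.
  intros ab.
  assert (e : 0 < b - a) by lra.
  exists (mkposreal _ e). intros y Hy ay.
  change (Rabs (y - a) < b - a) in Hy. apply Rabs_def2 in Hy. lra.
Qed.

Lemma right_limit_ge (f : R -> R) (a b l z : R) :
  a < b -> right_limit f a l -> (forall x, a < x < b -> z <= f x) -> z <= l.
Proof.
  intros ab Hl Hz.
  refine (filterlim_le (F := at_right a) (fun _ => z) f z l _ _ Hl).
  - generalize (at_right_interval a b ab). apply filter_imp. exact Hz.
  - apply filterlim_const.
Qed.

Lemma right_limit_le (f : R -> R) (a b l z : R) :
  a < b -> right_limit f a l -> (forall x, a < x < b -> f x <= z) -> l <= z.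
Proof.
  intros ab Hl Hz.
  refine (filterlim_le (F := at_right a) f (fun _ => z) l z _ Hl _).
  - generalize (at_right_interval a b ab). apply filter_imp. exact Hz.
  - apply filterlim_const.
Qed.

(** * The constants PI, q1 and q2 *)

(** A Machin-type series: [PI / 4] is the alternating sum of the series of
[2 * atan (1 / 3) + atan (1 / 7)]. *)
Lemma PI_bounds : 3.141592653589 < PI < 3.14159265359.
Proof.
  destruct (PI_2_3_7_ineq 6) as [l u]. revert l u.
  unfold tg_alt, PI_2_3_7_tg, Ratan_seq. cbn [sum_f_R0 Nat.mul Nat.add].
  rewrite !INR_IZR_INZ. cbn [Z.of_nat Pos.of_succ_nat Pos.succ]. intros. lra.
Qed.

Lemma q1_digits : 1.46740 <= q1 < 1.46741.
Proof. assert (P := PI_bounds). unfold q1. split; nra. Qed.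

Lemma q2_digits : 1.75193 <= q2 < 1.75194.
Proof.
  assert (P := PI_bounds). unfold q2. split.
  - left. apply Rmult_lt_reg_r with (PI - 2). lra.
    replace (2 / (PI - 2) * (PI - 2)) with 2 by (field; lra). lra.
  - apply Rmult_lt_reg_r with (PI - 2). lra.
    replace (2 / (PI - 2) * (PI - 2)) with 2 by (field; lra). lra.
Qed.

Lemma q1_pos : 0 < q1.
Proof. assert (H := q1_digits). lra. Qed.

Lemma q1_lt_q2 : q1 < q2.
Proof. assert (H1 := q1_digits). assert (H2 := q2_digits). lra. Qed.

(** * Shape of the error function in x, and its dependence on q *)

(** The derivative of [sin x / x] is [- w x / x ^ 2]. *)
Definition w (x : R) : R := sin x - x * cos x.

Lemma is_derive_w (x : R) : is_derive w x (x * sin x).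
Proof. unfold w. auto_derive; trivial. ring. Qed.

Lemma w_increasing (x y : R) : 0 <= x < y -> y <= PI -> w x < w y.
Proof.
  intros Hx Hy. apply (strict_increase w (fun x => x * sin x)); try lra.
  - intros z _. apply is_derive_w.
  - intros z Hz. apply Rmult_lt_0_compat. lra. apply sin_gt_0; lra.
Qed.

Lemma w_pos (x : R) : 0 < x <= PI -> 0 < w x.
Proof.
  intros Hx. replace 0 with (w 0) by (unfold w; rewrite sin_0; ring).
  apply w_increasing; lra.
Qed.

Lemma w_PI2 : w (PI / 2) = 1.
Proof. unfold w. rewrite sin_PI2, cos_PI2. ring. Qed.

(** The sign of the derivative of [elasticity]. The function and its first derivative
vanish at 0, and the second derivative is [- 4 * sin x * w x], which is negative. *)
Lemma elasticity_numerator (x : R) :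
  0 < x < PI -> 2 * sin x ^ 2 - x * sin x * cos x - x ^ 2 < 0.
Proof.
  intros Hx.
  set (g := fun x => 2 * sin x ^ 2 - x * sin x * cos x - x ^ 2).
  set (g1 := fun x => 3 * sin x * cos x - x * (cos x ^ 2 - sin x ^ 2) - 2 * x).
  assert (D1 : forall y, 0 < y <= x -> g1 y < 0).
  { intros y Hy.
    replace 0 with (g1 0) by (unfold g1; rewrite sin_0, cos_0; ring).
    apply (strict_decrease g1 (fun x => - (4 * (sin x * w x)))); try lra.
    - intros z _. unfold g1, w. auto_derive; trivial.
      generalize (sin2_cos2 z). unfold Rsqr. intros E.
      replace 2 with (2 * (sin z * sin z + cos z * cos z)) by (rewrite E; ring).
      ring_simplify. ring [E].
    - intros z Hz.
      assert (0 < sin z * w z).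
      { apply Rmult_lt_0_compat. apply sin_gt_0; lra. apply w_pos; lra. }
      lra. }
  change (g x < 0).
  replace 0 with (g 0) by (unfold g; rewrite sin_0; ring).
  apply (strict_decrease g g1); try lra.
  - intros z _. unfold g, g1. auto_derive; trivial. ring.
  - intros z Hz. apply D1. lra.
Qed.

(** The logarithmic derivative [x * w' x / w x]. *)
Definition elasticity (x : R) : R := x ^ 2 * sin x / w x.

Lemma is_derive_elasticity (x : R) : 0 < x < PI ->
  is_derive elasticity x (x * (2 * sin x ^ 2 - x * sin x * cos x - x ^ 2) / w x ^ 2).
Proof.
  intros Hx. assert (W := w_pos x ltac:(lra)).
  unfold elasticity, w in *. auto_derive. lra.
  generalize (sin2_cos2 x). unfold Rsqr. intros E.
  transitivity (x * (2 * sin x ^ 2 - x * sin x * cos x - x ^ 2 * (sin x * sin x + cos x * cos x)) / (sin x - x * cos x) ^ 2).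
  - field. lra.
  - rewrite E. field. lra.
Qed.

Lemma elasticity_decreasing (x y : R) : 0 < x < y -> y < PI -> elasticity y < elasticity x.
Proof.
  intros Hx Hy.
  apply (strict_decrease elasticity
    (fun x => x * (2 * sin x ^ 2 - x * sin x * cos x - x ^ 2) / w x ^ 2)); try lra.
  - intros z Hz. apply is_derive_elasticity; lra.
  - intros z Hz.
    assert (N := elasticity_numerator z ltac:(lra)).
    assert (W := w_pos z ltac:(lra)).
    assert (0 < z * - (2 * sin z ^ 2 - z * sin z * cos z - z ^ 2) / w z ^ 2).
    { apply Rdiv_lt_0_compat. apply Rmult_lt_0_compat; lra. now apply pow_lt. }
    unfold Rdiv in *. lra.
Qed.

Lemma elasticity_PI2 : elasticity (PI / 2) = q1 + 1.
Proof. unfold elasticity, q1. rewrite w_PI2, sin_PI2. field. Qed.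

(** The logarithm of [u ^ (q + 1) / w x] with [u = 2 * x / PI]; it has the sign of the
derivative of [phi q]. *)
Definition log_ratio (q x : R) : R := (q + 1) * ln (2 * x / PI) - ln (w x).

Lemma is_derive_log_ratio (q x : R) : 0 < x < PI ->
  is_derive (log_ratio q) x ((q + 1 - elasticity x) / x).
Proof.
  intros Hx. assert (W := w_pos x ltac:(lra)). assert (P := PI_RGT_0).
  unfold log_ratio, elasticity. unfold w in *. auto_derive.
  - repeat split; try lra. apply Rmult_lt_0_compat. lra. apply Rinv_0_lt_compat; lra.
  - field. lra.
Qed.

Lemma log_ratio_PI2 (q : R) : log_ratio q (PI / 2) = 0.
Proof.
  assert (P := PI_RGT_0). unfold log_ratio. rewrite w_PI2.
  replace (2 * (PI / 2) / PI) with 1 by (field; lra). rewrite ln_1. ring.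
Qed.

(** Since [log_ratio q] vanishes at [PI / 2], a nonnegative value at [x] forces a
nonpositive slope somewhere to the right of [x]. As the elasticity decreases, the slope
is then negative everywhere to the left of that point. *)
Lemma log_ratio_nonneg_left (q x y : R) :
  0 < y < x -> x < PI / 2 -> 0 <= log_ratio q x -> 0 < log_ratio q y.
Proof.
  intros Hy Hx H.
  destruct (MVT_open (log_ratio q) (fun x => (q + 1 - elasticity x) / x) x (PI / 2) Hx) as [z [Hz E]].
  { intros z Hz. apply is_derive_log_ratio. lra. }
  rewrite log_ratio_PI2 in E.
  assert (K : q + 1 <= elasticity z).
  { apply Rnot_lt_le. intros K.
    assert (0 < (q + 1 - elasticity z) / z * (PI / 2 - x)).
    { apply Rmult_lt_0_compat. apply Rdiv_lt_0_compat; lra. lra. }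
    lra. }
  apply Rle_lt_trans with (1 := H).
  apply (strict_decrease _ (fun x => (q + 1 - elasticity x) / x)). lra.
  - intros t Ht. apply is_derive_log_ratio. lra.
  - intros t Ht.
    assert (elasticity z < elasticity t) by (apply elasticity_decreasing; lra).
    assert (0 < (elasticity t - (q + 1)) / t) by (apply Rdiv_lt_0_compat; lra).
    unfold Rdiv in *. lra.
Qed.

Lemma log_ratio_q1_pos (x : R) : 0 < x < PI / 2 -> 0 < log_ratio q1 x.
Proof.
  intros Hx. rewrite <- (log_ratio_PI2 q1).
  apply (strict_decrease _ (fun x => (q1 + 1 - elasticity x) / x)). lra.
  - intros t Ht. apply is_derive_log_ratio. lra.
  - intros t Ht. rewrite <- elasticity_PI2.
    assert (elasticity (PI / 2) < elasticity t) by (apply elasticity_decreasing; lra).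
    assert (0 < (elasticity t - elasticity (PI / 2)) / t) by (apply Rdiv_lt_0_compat; lra).
    unfold Rdiv in *. lra.
Qed.

(** At [PI / 2] the slope of [log_ratio q] is positive, since the elasticity there is
[q1 + 1 < q + 1]; by monotonicity of the elasticity one point near [PI / 2] where it is
below [q + 1] suffices. *)
Lemma log_ratio_neg_near_end (q : R) : q1 < q ->
  exists a, 0 < a < PI / 2 /\ forall x, a <= x < PI / 2 -> log_ratio q x < 0.
Proof.
  intros Hq. assert (P := PI_RGT_0).
  assert (A : exists a, 0 < a < PI / 2 /\ elasticity a < q + 1).
  { assert (C : continuous elasticity (PI / 2)).
    { apply (ex_derive_continuous (V := R_NormedModule)). eexists. apply is_derive_elasticity. lra. }
    destruct (C (fun y => y < q + 1)) as [e He].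
    { apply (open_lt (q + 1)). rewrite elasticity_PI2. lra. }
    assert (E := cond_pos e).
    assert (M : 0 < Rmin (PI / 4) (e / 2)) by (apply Rmin_glb_lt; lra).
    assert (M1 := Rmin_l (PI / 4) (e / 2)).
    assert (M2 := Rmin_r (PI / 4) (e / 2)).
    exists (PI / 2 - Rmin (PI / 4) (e / 2)). split. lra.
    apply He. change (Rabs (PI / 2 - Rmin (PI / 4) (e / 2) - PI / 2) < e).
    apply Rabs_def1; lra. }
  destruct A as [a [Ha Ka]]. exists a. split. exact Ha.
  intros x Hx. rewrite <- (log_ratio_PI2 q).
  apply (strict_increase _ (fun x => (q + 1 - elasticity x) / x)). lra.
  - intros t Ht. apply is_derive_log_ratio. lra.
  - intros t Ht. apply Rdiv_lt_0_compat. 2: lra.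
    assert (elasticity t < elasticity a) by (apply elasticity_decreasing; lra). lra.
Qed.

(** Dividing [2 * x] by [PI] turns the factor [B q] into [2 / PI / q]. *)
Lemma phi_eq (q x : R) : 0 < q -> 0 < x ->
  phi q x = sin x / x - 2 / PI - 2 / PI * ((1 - Rpower (2 * x / PI) q) / q).
Proof.
  intros Hq Hx. assert (P := PI_RGT_0).
  unfold phi, B.
  replace (2 * x) with (PI * (2 * x / PI)) at 1 by (field; lra).
  rewrite <- Rpower_mult_distr; try lra.
  2: { apply Rdiv_lt_0_compat; lra. }
  rewrite Rpower_plus, Rpower_1 by lra.
  assert (Rpower PI q <> 0) by (apply Rgt_not_eq, exp_pos).
  field. lra.
Qed.

Lemma phi_approx (q x : R) : phi q x = sin x / x - approx q x.
Proof. unfold phi, approx. ring. Qed.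

Lemma phi_PI2 (q : R) : 0 < q -> phi q (PI / 2) = 0.
Proof.
  intros Hq. assert (P := PI_RGT_0). rewrite phi_eq by lra.
  replace (2 * (PI / 2) / PI) with 1 by (field; lra).
  unfold Rpower. rewrite ln_1, Rmult_0_r, exp_0, sin_PI2. field. lra.
Qed.

Definition dphi (q x : R) : R := (Rpower (2 * x / PI) (q + 1) - w x) / x ^ 2.

Lemma is_derive_phi (q x : R) : 0 < q -> 0 < x -> is_derive (phi q) x (dphi q x).
Proof.
  intros Hq Hx. assert (P := PI_RGT_0).
  assert (U : 0 < 2 * x / PI) by (apply Rdiv_lt_0_compat; lra).
  apply is_derive_ext_loc with
    (fun x => sin x / x - 2 / PI - 2 / PI * ((1 - Rpower (2 * x / PI) q) / q)).
  - apply (filter_imp (fun y => 0 < y)).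
    + intros y Hy. symmetry. now apply phi_eq.
    + now apply (open_gt 0).
  - unfold dphi. rewrite Rpower_plus, Rpower_1 by exact U. unfold Rpower, w.
    auto_derive.
    + repeat split; lra.
    + unfold Rdiv. field. lra.
Qed.

Lemma dphi_pos (q x : R) : 0 < x < PI -> 0 < log_ratio q x <-> 0 < dphi q x.
Proof.
  intros Hx. assert (W := w_pos x ltac:(lra)).
  assert (X : 0 < x ^ 2) by (apply pow_lt; lra).
  unfold log_ratio, dphi, Rpower. rewrite <- (exp_ln (w x)) at 2 by exact W.
  split; intros H.
  - apply Rdiv_lt_0_compat; trivial. apply Rlt_0_minus, exp_increasing. lra.
  - apply Rlt_0_minus, exp_lt_inv, Rminus_lt_0.
    apply Rmult_lt_reg_r with (/ x ^ 2). now apply Rinv_0_lt_compat.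
    rewrite Rmult_0_l. exact H.
Qed.

Lemma dphi_neg (q x : R) : 0 < x < PI -> log_ratio q x < 0 <-> dphi q x < 0.
Proof.
  intros Hx. assert (W := w_pos x ltac:(lra)).
  assert (X : 0 < x ^ 2) by (apply pow_lt; lra).
  unfold log_ratio, dphi, Rpower. rewrite <- (exp_ln (w x)) at 2 by exact W.
  split; intros H.
  - apply Rmult_lt_reg_r with (x ^ 2); trivial. unfold Rdiv.
    rewrite Rmult_assoc, Rinv_l by lra.
    enough (exp ((q + 1) * ln (2 * x / PI)) < exp (ln (w x))) by lra.
    apply exp_increasing. lra.
  - enough ((q + 1) * ln (2 * x / PI) < ln (w x)) by lra.
    apply exp_lt_inv.
    apply Rmult_lt_compat_r with (r := x ^ 2) in H; trivial.
    unfold Rdiv in H. rewrite Rmult_assoc, Rinv_l in H by lra. lra.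
Qed.

(** The limit of [phi q] at 0+. *)
Definition phi0 (q : R) : R := 1 - 2 / PI - 2 / PI / q.

Lemma phi_right_limit (q : R) : 0 < q -> right_limit (phi q) 0 (phi0 q).
Proof.
  intros Hq. assert (P := PI_RGT_0). unfold right_limit.
  apply filterlim_ext_loc with
    (fun x => sin x / x + (2 / PI / q * Rpower (2 * x / PI) q + (- (2 / PI) - 2 / PI / q))).
  { generalize (at_right_interval 0 1 Rlt_0_1). apply filter_imp.
    intros x Hx. rewrite phi_eq by lra. field. lra. }
  replace (phi0 q) with (1 + (2 / PI / q * 0 + (- (2 / PI) - 2 / PI / q))) by (unfold phi0; ring).
  assert (S : filterlim (fun x => sin x / x) (at_right 0) (locally 1)).
  { apply filterlim_filter_le_1 with (2 := is_lim_sinc_0).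
    intros Q [e He]. exists e. intros y Hy Hy0. apply He. exact Hy. lra. }
  assert (T : filterlim (fun x => Rpower (2 * x / PI) q) (at_right 0) (locally 0)).
  { unfold Rpower.
    apply (filterlim_comp _ _ _ (fun x => q * ln (2 * x / PI)) exp _ (Rbar_locally m_infty)).
    - apply (filterlim_comp _ _ _ (fun x => 2 * x / PI) (fun y => q * ln y) _ (at_right 0)).
      + intros Q [e He].
        assert (E : 0 < e * PI / 2).
        { apply Rdiv_lt_0_compat. 2: lra. apply Rmult_lt_0_compat. apply e. lra. }
        exists (mkposreal _ E). intros y Hy Hy0.
        change (Rabs (y - 0) < e * PI / 2) in Hy. apply Rabs_def2 in Hy.
        assert (0 < 2 * y / PI) by (apply Rdiv_lt_0_compat; lra).
        apply He. 2: assumption.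
        change (Rabs (2 * y / PI - 0) < e). rewrite Rminus_0_r, Rabs_pos_eq by lra.
        apply Rmult_lt_reg_r with PI. lra. unfold Rdiv.
        rewrite Rmult_assoc, Rinv_l by lra. lra.
      + eapply filterlim_comp. apply is_lim_ln_0.
        intros Q [M HM]. exists (M / q). intros y Hy. apply HM.
        apply Rmult_lt_reg_r with (/ q). now apply Rinv_0_lt_compat.
        replace (q * y * / q) with y by (field; lra). exact Hy.
    - exact is_lim_exp_m. }
  apply filterlim_comp_2 with (1 := S) (3 := filterlim_plus (V := R_NormedModule) _ _).
  apply filterlim_comp_2 with (3 := filterlim_plus (V := R_NormedModule) _ _).
  - eapply filterlim_comp. exact T.
    apply (filterlim_scal_r (V := R_NormedModule)).
  - apply filterlim_const.
Qed.

Lemma phi0_increasing (q q' : R) : 0 < q < q' -> phi0 q < phi0 q'.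
Proof.
  intros Hq. assert (P := PI_RGT_0). unfold phi0.
  assert (/ q' < / q) by (apply Rinv_lt_contravar; [apply Rmult_lt_0_compat|]; lra).
  assert (0 < 2 / PI) by (apply Rdiv_lt_0_compat; lra).
  assert (2 / PI * / q' < 2 / PI * / q) by (apply Rmult_lt_compat_l; lra).
  unfold Rdiv in *. lra.
Qed.

Lemma phi0_nondecreasing (q q' : R) : 0 < q <= q' -> phi0 q <= phi0 q'.
Proof.
  intros [Hq H]. destruct H as [H|H]. 2: rewrite H; lra.
  left. apply phi0_increasing. lra.
Qed.

Lemma phi0_q2 : phi0 q2 = 0.
Proof.
  assert (P := PI_RGT_0). assert (P2 := PI2_1). unfold phi0, q2. field. lra.
Qed.

Lemma phi0_nonpos (q : R) : 0 < q <= q2 -> phi0 q <= 0.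
Proof. intros Hq. rewrite <- phi0_q2. now apply phi0_nondecreasing. Qed.

Lemma Rpower_decreasing (u q q' : R) : 0 < u < 1 -> q < q' -> Rpower u q' < Rpower u q.
Proof.
  intros Hu Hq. unfold Rpower. apply exp_increasing.
  assert (ln u < 0) by (rewrite <- ln_1; apply ln_increasing; lra).
  assert (0 < (q' - q) * - ln u) by (apply Rmult_lt_0_compat; lra). lra.
Qed.

(** The difference [(1 - v ^ q) / q - (1 - v ^ q') / q'] has derivative
[(v ^ q' - v ^ q) / v < 0] on (0, 1), and it vanishes at [v = 1]. *)
Lemma power_gap_decreasing (u q q' : R) : 0 < u < 1 -> 0 < q < q' ->
  (1 - Rpower u q') / q' < (1 - Rpower u q) / q.
Proof.
  intros Hu Hq.
  set (D := fun v => (1 - Rpower v q) / q - (1 - Rpower v q') / q').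
  enough (D 1 < D u).
  { unfold D in H at 1. unfold Rpower in H at 1 2.
    rewrite ln_1, !Rmult_0_r, exp_0 in H. unfold D in H. lra. }
  apply (strict_decrease D (fun v => (Rpower v q' - Rpower v q) / v)). lra.
  - intros v Hv. unfold D, Rpower. auto_derive. repeat split; lra. field. lra.
  - intros v Hv.
    assert (H := Rpower_decreasing v q q' ltac:(lra) ltac:(lra)).
    assert (0 < (Rpower v q - Rpower v q') / v) by (apply Rdiv_lt_0_compat; lra).
    unfold Rdiv in *. lra.
Qed.

Lemma ratio_interval (x : R) : 0 < x < PI / 2 -> 0 < 2 * x / PI < 1.
Proof.
  intros Hx. split. apply Rdiv_lt_0_compat; lra.
  apply Rmult_lt_reg_r with PI. lra. unfold Rdiv. rewrite Rmult_assoc, Rinv_l; lra.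
Qed.

Lemma phi_increasing_q (q q' x : R) : 0 < q < q' -> 0 < x < PI / 2 ->
  phi q x < phi q' x.
Proof.
  intros Hq Hx. rewrite !phi_eq by lra.
  assert (H := power_gap_decreasing _ q q' (ratio_interval x Hx) Hq).
  assert (0 < 2 / PI) by (apply Rdiv_lt_0_compat; lra).
  apply Rmult_lt_compat_l with (r := 2 / PI) in H; lra.
Qed.

(** The gap is [phi0 q' - phi0 q - 2 / PI * (u ^ q / q - u ^ q' / q')], and the last
bracket is nonnegative because [u ^ q] and [1 / q] both decrease in [q]. *)
Lemma phi_gap_le (q q' x : R) : 0 < q < q' -> 0 < x < PI / 2 ->
  phi q' x - phi q x <= phi0 q' - phi0 q.
Proof.
  intros Hq Hx. rewrite !phi_eq by lra. unfold phi0.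
  assert (U := ratio_interval x Hx).
  assert (H := Rpower_decreasing _ q q' U ltac:(lra)).
  assert (I : / q' < / q) by (apply Rinv_lt_contravar; [apply Rmult_lt_0_compat|]; lra).
  assert (0 < 2 / PI) by (apply Rdiv_lt_0_compat; lra).
  set (a := Rpower _ q) in *. set (b := Rpower _ q') in *.
  assert (0 < b) by apply exp_pos.
  assert (0 < / q') by (apply Rinv_0_lt_compat; lra).
  assert (b * / q' <= a * / q) by (apply Rmult_le_compat; lra).
  assert (2 / PI * (b * / q') <= 2 / PI * (a * / q)) by (apply Rmult_le_compat_l; lra).
  unfold Rdiv in *. lra.
Qed.

(** * The maximum point *)

(** For [q1 < q <= q2] the set is an initial segment of (0, PI/2), by
[log_ratio_nonneg_left], and the supremum is its end point. *)
Definition peak (q : R) : R :=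
  real (Lub_Rbar (fun x => 0 < x < PI / 2 /\ 0 <= log_ratio q x)).

(** The set defining [peak q] is nonempty: otherwise [phi q] would strictly decrease on
the whole interval, from the limit [phi0 q <= 0] to the value 0. It stays away from
[PI / 2] by [log_ratio_neg_near_end]. *)
Lemma peak_spec (q : R) : q1 < q <= q2 ->
  0 < peak q < PI / 2 /\
  (forall x, 0 < x < peak q -> 0 < dphi q x) /\
  (forall x, peak q < x < PI / 2 -> dphi q x < 0).
Proof.
  intros Hq. assert (Q := q1_pos). assert (P := PI_RGT_0).
  assert (N : exists x, 0 < x < PI / 2 /\ 0 <= log_ratio q x).
  { apply NNPP. intros N.
    assert (D : forall x y, 0 < x < y -> y <= PI / 2 -> phi q y < phi q x).
    { intros x y Hx Hy. apply (strict_decrease _ (dphi q)). lra.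
      - intros z Hz. apply is_derive_phi; lra.
      - intros z Hz. apply dphi_neg. lra. apply Rnot_le_lt. intros H.
        apply N. exists z. split. lra. exact H. }
    assert (H1 : phi q (PI / 4) <= phi0 q).
    { apply (right_limit_ge (phi q) 0 (PI / 4)). lra. now apply phi_right_limit; lra.
      intros x Hx. left. apply D; lra. }
    assert (H2 := D (PI / 4) (PI / 2) ltac:(lra) ltac:(lra)).
    rewrite phi_PI2 in H2 by lra.
    assert (H3 : phi0 q <= 0).
    { apply phi0_nonpos. lra. }
    lra. }
  destruct N as [x0 [Hx0 N]].
  destruct (log_ratio_neg_near_end q (proj1 Hq)) as [a [Ha Na]].
  unfold peak.
  assert (S := Lub_Rbar_correct (fun x => 0 < x < PI / 2 /\ 0 <= log_ratio q x)).
  destruct (Lub_Rbar _) as [m| |]; destruct S as [S1 S2]; simpl.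
  - assert (M1 := S1 x0 (conj Hx0 N)). simpl in M1.
    assert (M2 : Rbar_le m a).
    { apply S2. intros y [Hy Py]. simpl. apply Rnot_lt_le. intros H.
      specialize (Na y ltac:(lra)). lra. }
    simpl in M2.
    split. lra. split.
    + intros x Hx. apply dphi_pos. lra.
      assert (E : exists y, x < y /\ 0 < y < PI / 2 /\ 0 <= log_ratio q y).
      { apply NNPP. intros E.
        assert (C : Rbar_le m x).
        { apply S2. intros y [Hy Py]. simpl. apply Rnot_lt_le. intros H.
          apply E. exists y. tauto. }
        simpl in C. lra. }
      destruct E as [y [H1 [H2 H3]]]. apply (log_ratio_nonneg_left q y); lra.
    + intros x Hx. apply dphi_neg. lra. apply Rnot_le_lt. intros H.
      assert (C : x <= m) by (apply (S1 x); split; [lra | exact H]). lra.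
  - exfalso. apply (S2 (Finite (PI / 2))). intros y [Hy _]. simpl. lra.
  - exfalso. apply (S1 x0). tauto.
Qed.

Lemma phi_increasing_left (q x y : R) : q1 < q <= q2 -> 0 < x < y -> y <= peak q ->
  phi q x < phi q y.
Proof.
  intros Hq Hx Hy. assert (Q := q1_pos). destruct (peak_spec q Hq) as [Hp [I D]].
  apply (strict_increase _ (dphi q)). lra.
  - intros z Hz. apply is_derive_phi; lra.
  - intros z Hz. apply I. lra.
Qed.

Lemma phi_decreasing_right (q x y : R) :
  q1 < q <= q2 -> peak q <= x < y -> y <= PI / 2 -> phi q y < phi q x.
Proof.
  intros Hq Hx Hy. assert (Q := q1_pos). destruct (peak_spec q Hq) as [Hp [I D]].
  apply (strict_decrease _ (dphi q)). lra.
  - intros z Hz. apply is_derive_phi; lra.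
  - intros z Hz. apply D. lra.
Qed.

Lemma phi_pos_right (q x : R) : q1 < q <= q2 -> peak q <= x < PI / 2 -> 0 < phi q x.
Proof.
  intros Hq Hx. assert (Q := q1_pos). rewrite <- (phi_PI2 q) by lra.
  apply phi_decreasing_right; lra.
Qed.

Lemma phi_le_peak (q x : R) : q1 < q <= q2 -> 0 < x < PI / 2 -> phi q x <= phi q (peak q).
Proof.
  intros Hq Hx.
  destruct (Rtotal_order x (peak q)) as [H|[H|H]].
  - left. apply phi_increasing_left; lra.
  - rewrite H. lra.
  - left. apply phi_decreasing_right; lra.
Qed.

Lemma phi_gt_right_limit (q x : R) : q1 < q <= q2 -> 0 < x < PI / 2 -> phi0 q < phi q x.
Proof.
  intros Hq Hx. assert (Q := q1_pos).
  destruct (Rle_lt_dec x (peak q)) as [H|H].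
  - apply Rle_lt_trans with (phi q (x / 2)).
    + apply (right_limit_le (phi q) 0 (x / 2)). lra. apply phi_right_limit; lra.
      intros y Hy. left. apply phi_increasing_left; lra.
    + apply phi_increasing_left; lra.
  - apply Rle_lt_trans with 0. apply phi0_nonpos; lra. apply phi_pos_right; lra.
Qed.

Lemma phi_q1_neg (x : R) : 0 < x < PI / 2 -> phi q1 x < 0.
Proof.
  intros Hx. assert (Q := q1_pos). rewrite <- (phi_PI2 q1) by lra.
  apply (strict_increase _ (dphi q1)). lra.
  - intros z Hz. apply is_derive_phi; lra.
  - intros z Hz. apply dphi_pos. lra. apply log_ratio_q1_pos. lra.
Qed.

Lemma phi_q2_pos (x : R) : 0 < x < PI / 2 -> 0 < phi q2 x.
Proof.
  intros Hx. assert (Q := q1_lt_q2). rewrite <- phi0_q2. apply phi_gt_right_limit; lra.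
Qed.

Lemma phi_nondecreasing_q (q q' x : R) : 0 < q <= q' -> 0 < x < PI / 2 ->
  phi q x <= phi q' x.
Proof.
  intros [Hq H] Hx. destruct H as [H|H]. 2: rewrite H; lra.
  left. apply phi_increasing_q; lra.
Qed.

Lemma neg_everywhere_le_q1 (q : R) : 0 < q ->
  (forall x, 0 < x < PI / 2 -> phi q x < 0) -> q <= q1.
Proof.
  intros Hq H. assert (Q := q1_pos). assert (Q2 := q1_lt_q2).
  apply Rnot_lt_le. intros C.
  destruct (Rle_lt_dec q q2) as [D|D].
  - destruct (peak_spec q ltac:(lra)) as [p _].
    specialize (H (peak q) p). assert (P := phi_pos_right q (peak q) ltac:(lra) ltac:(lra)). lra.
  - assert (P := PI_RGT_0). specialize (H (PI / 4) ltac:(lra)).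
    assert (E := phi_q2_pos (PI / 4) ltac:(lra)).
    assert (F := phi_nondecreasing_q q2 q (PI / 4) ltac:(lra) ltac:(lra)). lra.
Qed.

Lemma pos_everywhere_ge_q2 (q : R) : 0 < q ->
  (forall x, 0 < x < PI / 2 -> 0 < phi q x) -> q2 <= q.
Proof.
  intros Hq H. assert (P := PI_RGT_0). apply Rnot_lt_le. intros C.
  assert (E : 0 <= phi0 q).
  { apply (right_limit_ge (phi q) 0 (PI / 2)). lra. now apply phi_right_limit.
    intros x Hx. left. now apply H. }
  assert (F := phi0_increasing q q2 ltac:(lra)). rewrite phi0_q2 in F. lra.
Qed.

(** The limit at 0+ is negative for [q < q2], and [phi q] is positive on the right of
the peak, so the zero lies on the increasing branch. *)
Lemma phi_sign_change (q : R) : q1 < q < q2 ->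
  exists x0, 0 < x0 < PI / 2 /\ phi q x0 = 0 /\
    (forall x, 0 < x < x0 -> phi q x < 0) /\ (forall x, x0 < x < PI / 2 -> 0 < phi q x).
Proof.
  intros Hq. assert (Q := q1_pos).
  destruct (peak_spec q ltac:(lra)) as [Hp _].
  assert (E : exists x, 0 < x < peak q /\ phi q x < 0).
  { apply NNPP. intros N.
    assert (E : 0 <= phi0 q).
    { apply (right_limit_ge (phi q) 0 (peak q)). lra. apply phi_right_limit; lra.
      intros x Hx. apply Rnot_lt_le. intros C. apply N. now exists x. }
    assert (F := phi0_increasing q q2 ltac:(lra)). rewrite phi0_q2 in F. lra. }
  destruct E as [y [Hy N]].
  assert (M := phi_pos_right q (peak q) ltac:(lra) ltac:(lra)).
  destruct (Ranalysis5.IVT_interv (phi q) y (peak q)) as [x0 [Hx Z]]; try lra.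
  { intros z Hz. apply derivable_continuous_pt. exists (dphi q z).
    apply is_derive_Reals, is_derive_phi; lra. }
  exists x0. repeat split; try lra.
  - intros x Hx'. rewrite <- Z. apply phi_increasing_left; lra.
  - intros x Hx'. destruct (Rle_lt_dec x (peak q)) as [H|H].
    + rewrite <- Z. apply phi_increasing_left; lra.
    + apply phi_pos_right; lra.
Qed.

(** Elsewhere [phi q] is strictly monotone, so there is a larger value arbitrarily close
by, on the side of the peak. *)
Lemma peak_unique_local_max (q : R) : q1 < q <= q2 ->
  unique (local_max_on (phi q) 0 (PI / 2)) (peak q).
Proof.
  intros Hq. destruct (peak_spec q Hq) as [Hp _]. split.
  - split. exact Hp. exists 1. split. lra. intros x Hx _. now apply phi_le_peak.
  - intros m [Hm [e [He M]]].
    set (d := Rmin (e / 2) (Rmin (m / 2) ((PI / 2 - m) / 2))).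
    assert (D0 : 0 < d) by (repeat apply Rmin_glb_lt; lra).
    assert (D1 : d <= e / 2) by apply Rmin_l.
    assert (D2 : d <= Rmin (m / 2) ((PI / 2 - m) / 2)) by apply Rmin_r.
    assert (D3 := Rle_trans _ _ _ D2 (Rmin_l _ _)).
    assert (D4 := Rle_trans _ _ _ D2 (Rmin_r _ _)).
    destruct (Rtotal_order m (peak q)) as [H|[H|H]]. 2: easy.
    + exfalso. set (y := Rmin (m + d) (peak q)).
      assert (Y0 : m < y) by (apply Rmin_glb_lt; lra).
      assert (Y1 : y <= m + d) by apply Rmin_l.
      assert (Y2 : y <= peak q) by apply Rmin_r.
      assert (C := M y ltac:(lra) ltac:(apply Rabs_def1; lra)).
      assert (C' := phi_increasing_left q m y Hq ltac:(lra) Y2). lra.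
    + exfalso. set (y := Rmax (m - d) (peak q)).
      assert (Y0 : y < m) by (apply Rmax_lub_lt; lra).
      assert (Y1 : m - d <= y) by apply Rmax_l.
      assert (Y2 : peak q <= y) by apply Rmax_r.
      assert (C := M y ltac:(lra) ltac:(apply Rabs_def1; lra)).
      assert (C' := phi_decreasing_right q y m Hq ltac:(lra) ltac:(lra)). lra.
Qed.

(** * Balancing the two extreme errors *)

(** The largest value plus the smallest one; it vanishes exactly when the two have the
same absolute value. *)
Definition balance (q : R) : R := phi q (peak q) + phi0 q.

(** [phi_gap_le], evaluated at the peak for [q'], bounds the increase of the maximum by
the increase of [phi0]. *)
Lemma balance_increments (q q' : R) : q1 < q < q' -> q' <= q2 ->
  0 < balance q' - balance q <= 2 * (phi0 q' - phi0 q).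
Proof.
  intros Hq Hq'. assert (Q := q1_pos). unfold balance.
  destruct (peak_spec q ltac:(lra)) as [p _]. destruct (peak_spec q' ltac:(lra)) as [p' _].
  assert (A1 := phi0_increasing q q' ltac:(lra)).
  assert (A2 := phi_increasing_q q q' (peak q) ltac:(lra) p).
  assert (A3 := phi_le_peak q' (peak q) ltac:(lra) p).
  assert (A4 := phi_gap_le q q' (peak q') ltac:(lra) p').
  assert (A5 := phi_le_peak q (peak q') ltac:(lra) p').
  lra.
Qed.

Lemma balance_continuous (q : R) : q1 < q < q2 -> continuity_pt balance q.
Proof.
  intros Hq e He. assert (Q := q1_pos). assert (P := PI_RGT_0).
  assert (C : continuity_pt phi0 q).
  { apply derivable_continuous_pt. eexists. apply is_derive_Reals.
    unfold phi0. auto_derive. lra. reflexivity. }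
  destruct (C (e / 2) ltac:(lra)) as [d [Hd HL]].
  exists (Rmin d (Rmin (q - q1) (q2 - q))). split.
  { repeat apply Rmin_glb_lt; lra. }
  intros x [[_ Hx] Dx]. simpl in *. unfold R_dist in *.
  assert (M := Rmin_l d (Rmin (q - q1) (q2 - q))).
  assert (M' := Rmin_r d (Rmin (q - q1) (q2 - q))).
  assert (M1 := Rmin_l (q - q1) (q2 - q)). assert (M2 := Rmin_r (q - q1) (q2 - q)).
  specialize (HL x (conj (conj I Hx) (Rlt_le_trans _ _ _ Dx M))).
  apply Rabs_def2 in Dx. apply Rabs_def2 in HL.
  destruct (Rtotal_order x q) as [H|[H|H]].
  - assert (E := balance_increments x q ltac:(lra) ltac:(lra)). apply Rabs_def1; lra.
  - now elim Hx.
  - assert (E := balance_increments q x ltac:(lra) ltac:(lra)). apply Rabs_def1; lra.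
Qed.

Lemma sup_error_balanced (q : R) : q1 < q < q2 -> balance q = 0 ->
  sup_error phi 0 (PI / 2) q = Finite (phi q (peak q)).
Proof.
  intros Hq E. unfold balance in E. destruct (peak_spec q ltac:(lra)) as [p _].
  assert (M := phi_pos_right q (peak q) ltac:(lra) ltac:(lra)).
  apply is_lub_Rbar_unique. split.
  - intros y [x [Hx ->]]. simpl. apply Rabs_le. split.
    + assert (H := phi_gt_right_limit q x ltac:(lra) Hx). lra.
    + apply phi_le_peak; lra.
  - intros b Hb. apply (Hb (phi q (peak q))). exists (peak q). split. exact p.
    rewrite Rabs_pos_eq; lra.
Qed.

Lemma sup_error_ge (q d x : R) : sup_error phi 0 (PI / 2) q = Finite d ->
  0 < x < PI / 2 -> Rabs (phi q x) <= d.
Proof.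
  intros Hd Hx.
  destruct (Lub_Rbar_correct (fun y => exists x, 0 < x < PI / 2 /\ y = Rabs (phi q x)))
    as [U _].
  unfold sup_error in Hd. rewrite Hd in U. apply U. now exists x.
Qed.

(** An exponent above [q] does at least as badly at [peak q], and one below [q] does at
least as badly near 0. *)
Lemma min_error_balanced (q : R) : q1 < q < q2 -> balance q = 0 ->
  min_error phi 0 (PI / 2) = Finite (phi q (peak q)).
Proof.
  intros Hq E. assert (Q := q1_pos). assert (P := PI_RGT_0).
  destruct (peak_spec q ltac:(lra)) as [p _].
  apply is_glb_Rbar_unique. split.
  - intros d [q' [Hq' Hd]]. simpl.
    destruct (Rle_lt_dec q q') as [H|H].
    + assert (H1 := phi_nondecreasing_q q q' (peak q) ltac:(lra) p).
      assert (H2 := sup_error_ge q' d (peak q) Hd p).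
      assert (H3 := Rle_abs (phi q' (peak q))). lra.
    + enough (- d <= phi0 q) by (unfold balance in E; lra).
      apply (right_limit_ge (phi q) 0 (PI / 2)). lra. apply phi_right_limit; lra.
      intros x Hx. assert (H1 := phi_increasing_q q' q x ltac:(lra) Hx).
      assert (H2 := sup_error_ge q' d x Hd Hx).
      apply Rabs_le_between in H2. lra.
  - intros b Hb. apply Hb. exists q. split. lra. now apply sup_error_balanced.
Qed.

(** * Rational enclosures of exponentials, sines and cosines *)

(** Nested evaluation of [1 - x / (k + 1) * (1 - x / (k + 2) * ...)] with [n] nested levels.
For [k = 0] this is the Taylor polynomial of degree [n] of [exp (- x)]; the nested form
keeps the denominators small when it is evaluated at a rational point. *)
Fixpoint exp_horner (k n : nat) (x : R) : R :=
  match n with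
  | O => 1
  | S n => 1 - x / INR (S k) * exp_horner (S k) n x
  end.

Lemma exp_horner_last_term (n k : nat) (x : R) :
  exp_horner k (S n) x =
  exp_horner k n x + (- x) ^ S n * INR (Factorial.fact k) / INR (Factorial.fact (k + S n)).
Proof.
  revert k. induction n as [|n IH]; intros k.
  - rewrite Nat.add_1_r, fact_simpl, mult_INR.
    change (1 - x / INR (S k) * 1 =
      1 + (- x) ^ 1 * INR (Factorial.fact k) / (INR (S k) * INR (Factorial.fact k))).
    assert (N := not_0_INR (S k) (Nat.neq_succ_0 _)).
    assert (F := INR_fact_neq_0 k). field. now split.
  - change (1 - x / INR (S k) * exp_horner (S k) (S n) x =
      1 - x / INR (S k) * exp_horner (S k) n x
      + (- x) ^ S (S n) * INR (Factorial.fact k) / INR (Factorial.fact (k + S (S n)))).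
    rewrite IH. rewrite fact_simpl, mult_INR.
    replace (S k + S n)%nat with (k + S (S n))%nat by ring.
    assert (N := not_0_INR (S k) (Nat.neq_succ_0 _)).
    assert (F := INR_fact_neq_0 (k + S (S n))).
    rewrite <- (tech_pow_Rmult _ (S n)). field. now split.
Qed.

Definition exp_taylor : nat -> R -> R := exp_horner 0.

Lemma exp_taylor_S (n : nat) (x : R) :
  exp_taylor (S n) x = exp_taylor n x + (- x) ^ S n / INR (Factorial.fact (S n)).
Proof.
  unfold exp_taylor. rewrite exp_horner_last_term. simpl INR at 1.
  now rewrite Rmult_1_r.
Qed.

Lemma is_derive_exp_taylor (n : nat) (x : R) :
  is_derive (exp_taylor (S n)) x (- exp_taylor n x).
Proof.
  induction n as [|n IH].
  - unfold exp_taylor. simpl. auto_derive; trivial. field.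
  - rewrite (exp_taylor_S n).
    apply is_derive_ext with (1 := fun y => eq_sym (exp_taylor_S (S n) y)).
    rewrite Ropp_plus_distr.
    apply (is_derive_plus (V := R_NormedModule)) with (1 := IH).
    assert (F := INR_fact_neq_0 (S n)).
    assert (N := not_0_INR (S (S n)) (Nat.neq_succ_0 _)).
    rewrite (fact_simpl (S n)), mult_INR.
    set (f := INR (Factorial.fact (S n))) in *. set (m := INR (S (S n))) in *.
    auto_derive; trivial.
    change (- (1) * (m * (- x) ^ S n) * / (m * f) = - ((- x) ^ S n / f)).
    field. now split.
Qed.

(** By induction: the remainder of order [n + 1] vanishes at 0, and its derivative is
the opposite of the remainder of order [n]. *)
Lemma exp_taylor_alternates (n : nat) (x : R) : 0 <= x ->
  0 <= (-1) ^ S n * (exp (- x) - exp_taylor n x).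
Proof.
  revert x. induction n as [|n IH]; intros x Hx.
  - unfold exp_taylor. simpl. assert (exp (- x) <= 1).
    { rewrite <- exp_0. destruct Hx as [Hx|Hx].
      left; apply exp_increasing; lra. rewrite <- Hx, Ropp_0. lra. }
    lra.
  - set (r := fun x => (-1) ^ S (S n) * (exp (- x) - exp_taylor (S n) x)).
    change (0 <= r x).
    assert (R0 : r 0 = 0).
    { unfold r. replace (exp_taylor (S n) 0) with 1. rewrite Ropp_0, exp_0. ring.
      unfold exp_taylor. simpl exp_horner. unfold Rdiv. ring. }
    destruct Hx as [Hx|Hx]. 2: rewrite <- Hx, R0; lra.
    destruct (MVT_open r (fun x => (-1) ^ S n * (exp (- x) - exp_taylor n x)) 0 x Hx)
      as [c [Hc E]].
    + intros y _. unfold r.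
      replace ((-1) ^ S n * (exp (- y) - exp_taylor n y)) with
        ((-1) ^ S (S n) * (- exp (- y) - - exp_taylor n y)) by (simpl; ring).
      apply (is_derive_scal (fun y => exp (- y) - exp_taylor (S n) y)).
      apply (is_derive_minus (V := R_NormedModule)).
      auto_derive; trivial; ring. apply is_derive_exp_taylor.
    + rewrite R0 in E.
      assert (0 <= (-1) ^ S n * (exp (- c) - exp_taylor n c) * (x - 0)).
      { apply Rmult_le_pos. apply IH. lra. lra. }
      lra.
Qed.

Lemma exp_neg_bounds (n : nat) (x : R) : 0 <= x ->
  exp_taylor (2 * n + 1) x <= exp (- x) <= exp_taylor (2 * n) x.
Proof.
  intros Hx.
  assert (H1 := exp_taylor_alternates (2 * n) x Hx).
  assert (H2 := exp_taylor_alternates (2 * n + 1) x Hx).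
  replace (S (2 * n + 1)) with (2 * S n)%nat in H2 by ring.
  rewrite pow_1_odd in H1. rewrite pow_1_even in H2. lra.
Qed.

Ltac eval_exp n x :=
  let H := fresh in
  assert (H := exp_neg_bounds n x ltac:(lra)); revert H;
  unfold exp_taylor; cbn [exp_horner Nat.mul Nat.add]; rewrite !INR_IZR_INZ;
  cbn [Z.of_nat Pos.of_succ_nat Pos.succ]; intros; lra.

(** For [q] near 1.72287 the maximum point of [phi q] is about
[PI / 2 * exp (- 0.7049735)], so that the exponents 0.70498 and 0.70497 enclose it. *)
Lemma exp_left : 0.494118456526 < exp (- (0.70498)) < 0.494118456527.
Proof. eval_exp 7%nat 0.70498. Qed.

Lemma exp_right : 0.494123397735 < exp (- (0.70497)) < 0.494123397736.
Proof. eval_exp 7%nat 0.70497. Qed.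

Lemma exp_left_lo : 0.296830679788 < exp (- (0.70498 * 1.7228764)) < 0.296830679789.
Proof. eval_exp 9%nat (0.70498 * 1.7228764). Qed.

Lemma exp_right_lo : 0.296835793858 < exp (- (0.70497 * 1.7228764)) < 0.296835793859.
Proof. eval_exp 9%nat (0.70497 * 1.7228764). Qed.

Lemma exp_right_hi : 0.296835787789 < exp (- (0.70497 * 1.722876429)) < 0.296835787790.
Proof. eval_exp 9%nat (0.70497 * 1.722876429). Qed.

Ltac eval_trig :=
  unfold sin_approx, sin_term, cos_approx, cos_term; cbn [sum_f_R0 Nat.mul Nat.add];
  rewrite !fact_simpl, !mult_INR, !INR_IZR_INZ;
  cbn [Z.of_nat Pos.of_succ_nat Pos.succ Factorial.fact]; intros; lra.

Lemma sin_enclosure (l h x : R) : 0 <= l <= x -> x <= h <= 1 ->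
  sin_approx l 7 <= sin x <= sin_approx h 8.
Proof.
  intros Hl Hh. assert (P := PI_bounds).
  destruct (sin_bound l 3) as [A _]; try lra.
  destruct (sin_bound h 3) as [_ B]; try lra.
  assert (sin l <= sin x) by (apply sin_incr_1; lra).
  assert (sin x <= sin h) by (apply sin_incr_1; lra).
  simpl Nat.mul in *; simpl Nat.add in *. lra.
Qed.

Lemma cos_enclosure (l h x : R) : 0 <= l <= x -> x <= h <= 1 ->
  cos_approx h 7 <= cos x <= cos_approx l 8.
Proof.
  intros Hl Hh. assert (P := PI_bounds).
  destruct (cos_bound l 3) as [_ A]; try lra.
  destruct (cos_bound h 3) as [B _]; try lra.
  assert (cos h <= cos x) by (apply cos_decr_1; lra).
  assert (cos x <= cos l) by (apply cos_decr_1; lra).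
  simpl Nat.mul in *; simpl Nat.add in *. lra.
Qed.

Definition x_left : R := PI / 2 * exp (- (0.70498)).
Definition x_right : R := PI / 2 * exp (- (0.70497)).

Lemma x_left_bounds : 0.776159456512 < x_left < 0.776159456515.
Proof.
  unfold x_left. assert (P := PI_bounds). assert (E := exp_left). split; nra.
Qed.

Lemma x_right_bounds : 0.776167218145 < x_right < 0.776167218148.
Proof.
  unfold x_right. assert (P := PI_bounds). assert (E := exp_right). split; nra.
Qed.

Lemma sin_left : 0.700543944953 < sin x_left < 0.700543944956.
Proof.
  assert (X := x_left_bounds).
  assert (H := sin_enclosure 0.776159456512 0.776159456515 x_left ltac:(lra) ltac:(lra)).
  revert H. eval_trig.
Qed.

Lemma cos_left : 0.713609263663 < cos x_left < 0.713609263666.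
Proof.
  assert (X := x_left_bounds).
  assert (H := cos_enclosure 0.776159456512 0.776159456515 x_left ltac:(lra) ltac:(lra)).
  revert H. eval_trig.
Qed.

Lemma sin_right : 0.700549483705 < sin x_right < 0.700549483708.
Proof.
  assert (X := x_right_bounds).
  assert (H := sin_enclosure 0.776167218145 0.776167218148 x_right ltac:(lra) ltac:(lra)).
  revert H. eval_trig.
Qed.

Lemma cos_right : 0.713603826276 < cos x_right < 0.713603826279.
Proof.
  assert (X := x_right_bounds).
  assert (H := cos_enclosure 0.776167218145 0.776167218148 x_right ltac:(lra) ltac:(lra)).
  revert H. eval_trig.
Qed.

(** * Location of the balanced exponent *)

Lemma ratio_scaled (v : R) : 2 * (PI / 2 * v) / PI = v.
Proof. assert (P := PI_RGT_0). field. lra. Qed.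

Lemma Rpower_exp (r q : R) : Rpower (exp (- r)) q = exp (- (r * q)).
Proof. unfold Rpower. rewrite ln_exp. f_equal. ring. Qed.

Definition q_lo : R := 1.7228764.
Definition q_hi : R := 1.722876429.

Lemma dphi_left_pos : 0 < dphi q_lo x_left.
Proof.
  assert (X := x_left_bounds).
  unfold dphi. apply Rdiv_lt_0_compat. 2: apply pow_lt; lra.
  unfold x_left at 1. rewrite ratio_scaled, Rpower_plus, Rpower_1, Rpower_exp by apply exp_pos.
  assert (E := exp_left). assert (F := exp_left_lo). assert (S := sin_left). assert (C := cos_left).
  unfold w, q_lo.
  assert (0.296830679788 * 0.494118456526 < exp (- (0.70498 * 1.7228764)) * exp (- (0.70498)))
    by (apply Rmult_gt_0_lt_compat; lra).
  assert (0.776159456512 * 0.713609263663 < x_left * cos x_left) by (apply Rmult_gt_0_lt_compat; lra).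
  lra.
Qed.

Lemma dphi_right_neg : dphi q_lo x_right < 0.
Proof.
  assert (X := x_right_bounds).
  unfold dphi. apply Rdiv_neg_pos. 2: apply pow_lt; lra.
  unfold x_right at 1.
  rewrite ratio_scaled, Rpower_plus, Rpower_1, Rpower_exp by apply exp_pos.
  assert (E := exp_right). assert (F := exp_right_lo). assert (S := sin_right). assert (C := cos_right).
  unfold w, q_lo.
  assert (exp (- (0.70497 * 1.7228764)) * exp (- (0.70497)) < 0.296835793859 * 0.494123397736)
    by (apply Rmult_gt_0_lt_compat; try lra; apply exp_pos).
  assert (x_right * cos x_right < 0.776167218148 * 0.713603826279) by (apply Rmult_gt_0_lt_compat; lra).
  lra.
Qed.

Lemma peak_lo : x_left <= peak q_lo <= x_right.
Proof.
  assert (X1 := x_left_bounds). assert (X2 := x_right_bounds).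
  assert (H1 := q1_digits). assert (H2 := q2_digits). assert (P := PI_bounds).
  destruct (peak_spec q_lo) as [p [I D]]. unfold q_lo; lra.
  assert (A := dphi_left_pos). assert (B := dphi_right_neg).
  split; apply Rnot_lt_le; intros H.
  - specialize (D x_left ltac:(lra)). lra.
  - specialize (I x_right ltac:(lra)). lra.
Qed.

Lemma phi_at_scaled (q v : R) : 0 < q -> 0 < v ->
  phi q (PI / 2 * v) + phi0 q =
  2 / PI * (sin (PI / 2 * v) / v + Rpower v q / q - 2 / q - 2 + PI / 2).
Proof.
  intros Hq Hv. assert (P := PI_RGT_0).
  assert (0 < PI / 2 * v) by (apply Rmult_lt_0_compat; lra).
  rewrite phi_eq, ratio_scaled by lra. unfold phi0. field. lra.
Qed.

(** In the numerator [u ^ (q_lo + 1) - w c] both terms increase, so it is at most the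
value of the first at [x_right] minus the value of the second at [x_left]. *)
Lemma dphi_small (c : R) : x_left <= c <= x_right -> dphi q_lo c < 0.00002.
Proof.
  intros Hc. assert (X1 := x_left_bounds). assert (X2 := x_right_bounds). assert (P := PI_bounds).
  unfold dphi. apply Rmult_lt_reg_r with (c ^ 2). apply pow_lt; lra.
  replace ((Rpower (2 * c / PI) (q_lo + 1) - w c) / c ^ 2 * c ^ 2)
    with (Rpower (2 * c / PI) (q_lo + 1) - w c) by (field; lra).
  assert (0.6 < c ^ 2) by nra.
  assert (W : w x_left <= w c).
  { destruct (proj1 Hc) as [H1|H1]. left; apply w_increasing; lra. rewrite H1; lra. }
  assert (U : Rpower (2 * c / PI) (q_lo + 1) <= exp (- (0.70497 * 1.7228764)) * exp (- (0.70497))).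
  { rewrite <- (Rpower_exp 0.70497 1.7228764).
    rewrite <- (Rpower_1 (exp (- (0.70497)))) at 2 by apply exp_pos.
    rewrite <- Rpower_plus. fold q_lo. apply Rle_Rpower_l. unfold q_lo; lra.
    split. apply Rdiv_lt_0_compat; lra.
    rewrite <- (ratio_scaled (exp (- (0.70497)))). fold x_right.
    apply Rmult_le_compat_r. left; apply Rinv_0_lt_compat; lra. lra. }
  assert (E := exp_right). assert (F := exp_right_lo). assert (S := sin_left). assert (C := cos_left).
  assert (exp (- (0.70497 * 1.7228764)) * exp (- (0.70497)) < 0.296835793859 * 0.494123397736)
    by (apply Rmult_gt_0_lt_compat; try lra; apply exp_pos).
  assert (x_left * cos x_left < 0.776159456515 * 0.713609263666) by (apply Rmult_gt_0_lt_compat; lra).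
  unfold w in W at 1. lra.
Qed.

(** The enclosure of the peak has length about 8e-6 and the slope there is below 2e-5,
so the maximum exceeds the value at [x_left] by less than 2e-10. The balance is about
-8e-9. *)
Lemma balance_lo : balance q_lo < 0.
Proof.
  unfold balance.
  assert (X1 := x_left_bounds). assert (X2 := x_right_bounds). assert (P := PI_bounds).
  assert (K := peak_lo).
  assert (H1 : phi q_lo (peak q_lo) <= phi q_lo x_left + 0.0000000002).
  { destruct (proj1 K) as [H|H]. 2: rewrite <- H; lra.
    destruct (MVT_open (phi q_lo) (dphi q_lo) x_left (peak q_lo) H) as [c [Hc E]].
    - intros x Hx. apply is_derive_phi. unfold q_lo; lra. lra.
    - assert (D := dphi_small c ltac:(lra)).
      assert (dphi q_lo c * (peak q_lo - x_left) <= 0.00002 * (peak q_lo - x_left))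
        by (apply Rmult_le_compat_r; lra).
      lra. }
  enough (H2 : phi q_lo x_left + phi0 q_lo < - 0.000000001) by lra.
  unfold x_left. rewrite phi_at_scaled, Rpower_exp. fold x_left.
  2: unfold q_lo; lra. 2: apply exp_pos.
  assert (E := exp_left). assert (F := exp_left_lo). assert (S := sin_left). fold q_lo in F.
  set (a := exp (- (0.70498))) in *. set (b := exp (- (0.70498 * q_lo))) in *.
  assert (V : sin x_left / a < 1.41776518506).
  { apply Rmult_lt_reg_r with a. lra. unfold Rdiv. rewrite Rmult_assoc, Rinv_l; lra. }
  assert (Y : sin x_left / a + b / q_lo - 2 / q_lo - 2 + PI / 2 < - 0.000000005)
    by (unfold q_lo; lra).
  assert (T : 0.5 < 2 / PI).
  { apply Rmult_lt_reg_r with PI. lra. unfold Rdiv. rewrite Rmult_assoc, Rinv_l; lra. }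
  assert (0.5 * 0.000000005 < 2 / PI * - (sin x_left / a + b / q_lo - 2 / q_lo - 2 + PI / 2))
    by (apply Rmult_gt_0_lt_compat; lra).
  lra.
Qed.

(** The left-hand side is about 4e-10, which dictates the twelve decimals kept in the
enclosures. *)
Lemma balance_hi_at_right : 0 < phi q_hi x_right + phi0 q_hi.
Proof.
  assert (X2 := x_right_bounds). assert (P := PI_bounds).
  unfold x_right. rewrite phi_at_scaled, Rpower_exp. fold x_right.
  2: unfold q_hi; lra. 2: apply exp_pos.
  assert (E := exp_right). assert (F := exp_right_hi). assert (S := sin_right). fold q_hi in F.
  set (a := exp (- (0.70497))) in *. set (b := exp (- (0.70497 * q_hi))) in *.
  apply Rmult_lt_0_compat. apply Rdiv_lt_0_compat; lra.
  assert (V : 1.41776221671 < sin x_right / a).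
  { apply Rmult_lt_reg_r with a. lra. unfold Rdiv. rewrite Rmult_assoc, Rinv_l; lra. }
  unfold q_hi; lra.
Qed.

Lemma balance_hi : 0 < balance q_hi.
Proof.
  assert (X2 := x_right_bounds). assert (P := PI_bounds).
  assert (H1 := q1_digits). assert (H2 := q2_digits).
  assert (H := balance_hi_at_right).
  assert (M := phi_le_peak q_hi x_right ltac:(unfold q_hi; lra) ltac:(lra)).
  unfold balance. lra.
Qed.

(** * Decimals of the error and of B *)

Lemma phi0_lo : - 0.0061297 < phi0 q_lo.
Proof.
  assert (P := PI_bounds).
  assert (/ PI < / 3.141592653589) by (apply Rinv_lt_contravar; nra).
  unfold phi0, q_lo, Rdiv. lra.
Qed.

Lemma phi0_hi : phi0 q_hi < - 0.0061296.
Proof.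
  assert (P := PI_bounds).
  assert (/ 3.14159265359 < / PI) by (apply Rinv_lt_contravar; nra).
  unfold phi0, q_hi, Rdiv. lra.
Qed.

Lemma ln_PI_bounds : 1.14472988 < ln PI < 1.14472989.
Proof.
  assert (P := PI_bounds).
  assert (Hl : 0.318309888 < exp (- (1.14472988))) by eval_exp 8%nat 1.14472988.
  assert (Hu : exp (- (1.14472989)) < 0.318309885) by eval_exp 8%nat 1.14472989.
  rewrite exp_Ropp in Hl, Hu.
  split; apply exp_lt_inv; rewrite exp_ln by lra.
  - apply Rinv_lt_cancel. lra. apply Rlt_trans with (2 := Hl).
    apply Rlt_le_trans with (/ 3.141592653589). apply Rinv_lt_contravar; nra. lra.
  - apply Rinv_lt_cancel. apply exp_pos. apply Rlt_trans with (1 := Hu).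
    apply Rle_lt_trans with (/ 3.14159265359). lra. apply Rinv_lt_contravar; nra.
Qed.

(** The exponent [q + 1] is close to 3, so that the remaining exponential has a small
argument and [ln PI] is needed only to eight decimals. *)
Lemma Rpower_PI_split (q : R) :
  Rpower PI (q + 1) = PI ^ 3 * exp (- ((2 - q) * ln PI)).
Proof.
  assert (P := PI_RGT_0).
  replace (q + 1) with (INR 3 + - (2 - q)) by (simpl; ring).
  rewrite Rpower_plus, Rpower_pow by lra. unfold Rpower. do 2 f_equal. ring.
Qed.

Lemma PI_cube_bounds : 31.00627668 < PI ^ 3 < 31.00627669.
Proof.
  assert (P := PI_bounds).
  assert (9.869604401 < PI * PI < 9.869604402) by nra.
  replace (PI ^ 3) with (PI * PI * PI) by ring.
  assert (9.869604401 * 3.141592653589 < PI * PI * PI) by (apply Rmult_gt_0_lt_compat; lra).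
  assert (PI * PI * PI < 9.869604402 * 3.14159265359) by (apply Rmult_gt_0_lt_compat; lra).
  lra.
Qed.

Lemma B_decreasing (q q' : R) : 0 < q <= q' -> B q' <= B q.
Proof.
  intros Hq. assert (P := PI_bounds). unfold B, Rdiv.
  apply Rmult_le_compat_l. lra. apply Rinv_le_contravar.
  - apply Rmult_lt_0_compat. lra. apply exp_pos.
  - apply Rmult_le_compat. lra. left; apply exp_pos. lra. apply Rle_Rpower; lra.
Qed.

Lemma B_lo : B q_lo < 0.051416.
Proof.
  assert (P := PI_cube_bounds). assert (N := ln_PI_bounds).
  unfold B. rewrite Rpower_PI_split.
  assert (E : 0.728162043 < exp (- ((2 - q_lo) * ln PI))).
  { apply Rlt_le_trans with (exp (- (0.2771236 * 1.14472989))).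
    eval_exp 6%nat (0.2771236 * 1.14472989).
    apply Rlt_le, exp_increasing. unfold q_lo. lra. }
  set (e := exp _) in *.
  assert (31.00627668 * 0.728162043 < PI ^ 3 * e) by (apply Rmult_gt_0_lt_compat; lra).
  assert (D : 0 < q_lo * (PI ^ 3 * e)) by (unfold q_lo; lra).
  apply Rmult_lt_reg_r with (1 := D). unfold Rdiv.
  rewrite Rmult_assoc, Rinv_l by lra. unfold q_lo. lra.
Qed.

Lemma B_hi : 0.051415 <= B q_hi.
Proof.
  assert (P := PI_cube_bounds). assert (N := ln_PI_bounds).
  unfold B. rewrite Rpower_PI_split.
  assert (E : exp (- ((2 - q_hi) * ln PI)) < 0.728163).
  { apply Rle_lt_trans with (exp (- (0.277123571 * 1.14472988))).
    apply Rlt_le, exp_increasing. unfold q_hi. lra.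
    eval_exp 6%nat (0.277123571 * 1.14472988). }
  assert (E0 := exp_pos (- ((2 - q_hi) * ln PI))).
  set (e := exp _) in *.
  assert (PI ^ 3 * e < 31.00627669 * 0.728163) by (apply Rmult_gt_0_lt_compat; lra).
  assert (0 < PI ^ 3 * e) by (apply Rmult_lt_0_compat; lra).
  assert (D : 0 < q_hi * (PI ^ 3 * e)) by (unfold q_hi; lra).
  left. apply Rmult_lt_reg_r with (1 := D). unfold Rdiv.
  rewrite Rmult_assoc, Rinv_l by lra. unfold q_hi. lra.
Qed.

(** * The theorem *)

Theorem mainTheorem3 :
  leading_digits 5 1.46740 q1 /\
  leading_digits 5 1.75193 q2 /\
  (* (i) *)
  ((forall q : R, 0 < q <= q1 ->
      forall x : R, 0 < x < PI / 2 ->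
        sin x / x < approx q1 x /\ approx q1 x <= approx q x) /\
   (forall q : R, 0 < q ->
      (forall x : R, 0 < x < PI / 2 -> sin x / x < approx q x) -> q <= q1)) /\
  (* (ii) *)
  (forall q : R, q1 < q < q2 ->
     exists x0 : R,
       unique (fun x => 0 < x < PI / 2 /\ phi q x = 0) x0 /\
       (forall x : R, 0 < x < x0 -> sin x / x < approx q x) /\
       (forall x : R, x0 < x < PI / 2 -> sin x / x > approx q x)) /\
  (* (iii) *)
  ((forall q : R, q2 <= q ->
      forall x : R, 0 < x < PI / 2 ->
        sin x / x > approx q2 x /\ approx q2 x >= approx q x) /\
   (forall q : R, 0 < q ->
      (forall x : R, 0 < x < PI / 2 -> sin x / x > approx q x) -> q2 <= q)) /\
  (* (iv) and (v): [m q] is the maximum point, [L q] is the limit at 0+ *)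
  exists m L : R -> R,
    (forall q : R, q1 < q <= q2 ->
       unique (local_max_on (phi q) 0 (PI / 2)) (m q)) /\
    (forall q : R, 0 < q -> right_limit (phi q) 0 (L q)) /\
    exists q0 d0 : R,
      unique (fun q => q1 < q < q2 /\ Rabs (L q) = Rabs (phi q (m q))) q0 /\
      leading_digits 5 1.72287 q0 /\
      d0 = Rabs (L q0) /\
      d0 = Rabs (phi q0 (m q0)) /\
      leading_digits 7 0.0061296 d0 /\
      Finite d0 = min_error phi 0 (PI / 2) /\
      minimax_approximant phi 0 (PI / 2) q0 /\
      leading_digits 6 0.051415 (B q0).
Proof.
  assert (Q1 := q1_digits). assert (Q2 := q2_digits). assert (P := PI_RGT_0).
  split; [|split; [|split; [|split; [|split]]]].
  - unfold leading_digits. lra.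
  - unfold leading_digits. lra.
  - split.
    + intros q Hq x Hx.
      assert (H1 := phi_q1_neg x Hx). assert (H2 := phi_nondecreasing_q q q1 x Hq Hx).
      rewrite !phi_approx in *. lra.
    + intros q Hq H. apply neg_everywhere_le_q1. exact Hq.
      intros x Hx. specialize (H x Hx). rewrite phi_approx. lra.
  - intros q Hq. destruct (phi_sign_change q Hq) as [x0 [Hx0 [Z [N S]]]].
    exists x0. repeat split; trivial; try lra.
    + intros y [Hy Zy]. destruct (Rtotal_order x0 y) as [H|[H|H]]; trivial.
      * specialize (S y ltac:(lra)). lra.
      * specialize (N y ltac:(lra)). lra.
    + intros x Hx. specialize (N x Hx). rewrite phi_approx in N. lra.
    + intros x Hx. specialize (S x Hx). rewrite phi_approx in S. lra.
  - split.
    + intros q Hq x Hx.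
      assert (H1 := phi_q2_pos x Hx).
      assert (H2 := phi_nondecreasing_q q2 q x ltac:(lra) Hx).
      rewrite !phi_approx in *. lra.
    + intros q Hq H. apply pos_everywhere_ge_q2. exact Hq.
      intros x Hx. specialize (H x Hx). rewrite phi_approx. lra.
  - exists peak, phi0. split; [|split].
    + exact peak_unique_local_max.
    + exact phi_right_limit.
    + assert (Hlo : q1 < q_lo < q2) by (unfold q_lo; lra).
      assert (Hhi : q1 < q_hi < q2) by (unfold q_hi; lra).
      destruct (Ranalysis5.IVT_interv balance q_lo q_hi) as [q0 [Hq0 E]].
      { intros q Hq. apply balance_continuous. lra. }
      { unfold q_lo, q_hi. lra. }
      { exact balance_lo. }
      { exact balance_hi. }
      assert (Hq : q1 < q0 < q2) by lra.
      assert (S : forall q, q1 < q < q2 ->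
        Rabs (phi0 q) = - phi0 q /\ Rabs (phi q (peak q)) = phi q (peak q)).
      { intros q H. destruct (peak_spec q ltac:(lra)) as [p _].
        assert (H1 := phi_pos_right q (peak q) ltac:(lra) ltac:(lra)).
        assert (H2 := phi0_nonpos q ltac:(lra)).
        split. now apply Rabs_left1. apply Rabs_pos_eq. lra. }
      destruct (S q0 Hq) as [S1 S2].
      assert (M := min_error_balanced q0 Hq E).
      assert (D := sup_error_balanced q0 Hq E).
      unfold balance in E.
      assert (E' : phi q0 (peak q0) = - phi0 q0) by lra.
      rewrite E' in M, D. exists q0, (- phi0 q0).
      split; [|split; [|split; [|split; [|split; [|split; [|split]]]]]].
      * split. split. exact Hq. now rewrite S1, S2.
        intros q [H R]. destruct (S q H) as [T1 T2].
        assert (Z : balance q = 0) by (unfold balance; lra).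
        assert (Z0 : balance q0 = 0) by (unfold balance; lra).
        destruct (Rtotal_order q0 q) as [C|[C|C]]; trivial.
        -- assert (I := balance_increments q0 q ltac:(lra) ltac:(lra)). lra.
        -- assert (I := balance_increments q q0 ltac:(lra) ltac:(lra)). lra.
      * unfold leading_digits, q_lo, q_hi in *. lra.
      * now symmetry.
      * now rewrite S2.
      * assert (A1 := phi0_lo). assert (A2 := phi0_hi).
        assert (I1 : phi0 q_lo <= phi0 q0) by (apply phi0_nondecreasing; lra).
        assert (I2 : phi0 q0 <= phi0 q_hi) by (apply phi0_nondecreasing; lra).
        unfold leading_digits. lra.
      * now symmetry.
      * split. lra. now rewrite D, M.
      * assert (A1 := B_lo). assert (A2 := B_hi).
        assert (I1 : B q0 <= B q_lo) by (apply B_decreasing; lra).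
        assert (I2 : B q_hi <= B q0) by (apply B_decreasing; lra).
        unfold leading_digits. lra.
Qed.
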